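(* Let $c,d\in\mathbb{N}$ such that $cd>1$. Then the Baumslag–Solitar monoid $S=BS(c,d)^+$, i.e. the monoid generated by two elements $a,b$ subject to the relation $ab^c=b^da$, is admissible with $\beta_c=1$, and the following statements hold: (i) The action $\alpha$ is almost free if and only if $\alpha$ is faithful if and only if $c\notin d\mathbb{N}$. (ii) $S$ has finite propagation if and only if $c\le d$.
   Context: All semigroups are countable discrete monoids; $\mathbb{N}^\times$ is the multiplicative monoid of positive integers. It is known that $BS(c,d)^+$ is right LCM. **Right LCM semigroups.** A monoid $S$ is right LCM if it is left cancellative and for all $s,t\in S$ the set $sS\cap tS$ is empty or of the form $rS$; such $r$ is a right LCM of $s,t$. $S^*$ is the group of invertible elements. $S_c=\{x\in S: xS\cap sS\ne\emptyset\ \forall s\in S\}$. $S_{ci}$ is the set of $s\in S\setminus S_c$ such that every factorisation $s=tx$ with $x\in S_c$ forces $x\in S^*$; $S_{ci}^1=S_{ci}\cup\{1\}$. $s\sim t$ means $sx=ty$ for some $x,y\in S_c$; $[s]$ is the class of $s$. A transversal for $A/_\sim$, $A\subset S$, is a subset of $A$ that is a minimal complete set of representatives. A finite $F\subset S$ is a foundation set if every $s\in S$ satisfies $sS\cap fS\neq\emptyset$ for some $f\in F$; it is accurate if $fS\cap f'S=\emptyset$ for distinct $f,f'\in F$. **Admissibility.** For a submonoid $M$ of $\mathbb{N}^\times$, $\mathrm{Irr}(M)$ is the set of $m\in M$, $m\ne1$, such that $m=kl$ with $k,l\in M$ implies $k=1$ or $l=1$. $S$ is admissible if: (A1) $S=S_{ci}^1S_c$;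 (A2) any right LCM of two elements of $S_{ci}$ belongs to $S_{ci}$; (A3) there is a nontrivial monoid homomorphism $N\colon S\to\mathbb{N}^\times$ (a generalised scale) such that (a) $|N^{-1}(n)/_\sim|=n$ for all $n\in N(S)$ and (b) for each $n\in N(S)$ every transversal of $N^{-1}(n)/_\sim$ is an accurate foundation set for $S$; (A4) $N(S)$ is the free abelian monoid in $\mathrm{Irr}(N(S))$. The critical inverse temperature $\beta_c\in\mathbb{R}\cup\{\infty\}$ is the smallest value such that $\zeta_S(\beta)=\sum_{n\in N(S)}n^{-(\beta-1)}$ is finite for all real $\beta>\beta_c$. Here the generalised scale on $S=BS(c,d)^+$ is the homomorphism determined by $N_a=d$, $N_b=1$. **The action $\alpha$.** $\alpha\colon S_c\curvearrowright S/_\sim$, $\alpha_x([s])=[xs]$. It is faithful if for all $x\neq y$ in $S_c$ there is $z\in S/_\sim$ with $\alpha_x(z)\neq\alpha_y(z)$, and almost free if $\{z\in S/_\sim:\alpha_x(z)=\alpha_y(z)\}$ is finite for all $x\ne y$ in $S_c$. **Finite propagation.** For an admissible $S$ and a transversal $\mathcal{T}$ for $S/_\sim$ with $\mathcal{T}\subset S_{ci}^1$, each $s\in S$ is uniquely $s=i(s)\,\mathsf{c}(s)$ with $i(s)\in\mathcal{T}$, $\mathsf{c}(s)\in S_c$; put $C_x=\{\mathsf{c}(xf):f\in\mathcal{T}\}$ for $x\in S_c$. $S$ has finite propagation if for every $(x,y)\in S_c\times S_c$ there is such a $\mathcal{T}$ for which $C_x$ and $C_y$ are finite.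
   Formalization: The formal theorem additionally assumes d > 1; for d = 1 and c ≥ 2 the claim fails, since the scale with N_a = N_b = 1 is trivial, S/~ is a single point (so α is almost free but not faithful), and finite propagation holds although c > d. *)

(* Defs.v *)
From Stdlib Require Import Relation_Operators.
From HB Require Import structures.
From mathcomp Require Import all_boot all_order all_algebra.
From mathcomp Require Import all_classical all_reals all_analysis.

Set Implicit Arguments.
Unset Strict Implicit.
Unset Printing Implicit Defensive.

Import Order.TTheory GRing.Theory Num.Theory.
Local Open Scope classical_set_scope.
Local Open Scope group_scope.

(* The monoid < X | r >: words over X modulo the smallest congruence
   containing r. *)
Section Presentation.
Variables (X : choiceType) (r : seq X -> seq X -> Prop).

Inductive rewrite_step : seq X -> seq X -> Prop :=
| RewriteStep u v l m : r l m -> rewrite_step (u ++ l ++ v) (u ++ m ++ v).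

Definition word_cong : seq X -> seq X -> Prop := clos_refl_sym_trans _ rewrite_step.

Lemma word_cong_ctx p q u v :
  word_cong u v -> word_cong (p ++ u ++ q) (p ++ v ++ q).
Proof.
elim=> {u v} [_ _ [u v l m lm]|u|u v _|u v w _ uv _ vw].
- apply: rst_step; rewrite -!catA !(catA p).
  exact: RewriteStep.
- exact: rst_refl.
- exact: rst_sym.
- exact: rst_trans uv vw.
Qed.

Lemma word_cong_cat u u' v v' :
  word_cong u u' -> word_cong v v' -> word_cong (u ++ v) (u' ++ v').
Proof.
move=> uu vv; apply: (@rst_trans _ _ _ (u' ++ v)).
- exact: (@word_cong_ctx [::] v).
- by have := @word_cong_ctx u' [::] _ _ vv; rewrite !cats0.
Qed.

Definition word_congb (u v : seq X) : bool := `[< word_cong u v >].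

Lemma word_congb_refl : reflexive word_congb.
Proof. by move=> u; apply/asboolP/rst_refl. Qed.

Lemma word_congb_sym : symmetric word_congb.
Proof. by move=> u v; apply/asboolP/asboolP; apply: rst_sym. Qed.

Lemma word_congb_trans : transitive word_congb.
Proof.
move=> v u w /asboolP uv /asboolP vw; apply/asboolP.
exact: rst_trans uv vw.
Qed.

Canonical word_congb_equiv :=
  EquivRel word_congb word_congb_refl word_congb_sym word_congb_trans.

Definition presented_monoid : Type := {eq_quot word_congb}%qT.
HB.instance Definition _ := Choice.on presented_monoid.

Definition word_class (u : seq X) : presented_monoid :=
  (\pi_{eq_quot word_congb} u)%qT.

Lemma word_classP u v : word_class u = word_class v <-> word_cong u v.
Proof.
split=> [/eqquotP/asboolP //|uv]; apply/eqquotP; exact/asboolP.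
Qed.

Definition presented_one : presented_monoid := word_class [::].
Definition presented_mul (x y : presented_monoid) : presented_monoid :=
  word_class (repr (x : {eq_quot word_congb}%qT)
              ++ repr (y : {eq_quot word_congb}%qT)).

Lemma word_class_reprK (x : presented_monoid) :
  word_class (repr (x : {eq_quot word_congb}%qT)) = x.
Proof. exact: reprK. Qed.

Lemma word_class_ind (P : presented_monoid -> Prop) :
  (forall u, P (word_class u)) -> forall x, P x.
Proof. by move=> Pu x; rewrite -(word_class_reprK x). Qed.

Lemma presented_mulE u v :
  presented_mul (word_class u) (word_class v) = word_class (u ++ v).
Proof.
by apply/word_classP/word_cong_cat; apply/word_classP; rewrite word_class_reprK.
Qed.

Lemma presented_mulA : associative presented_mul.
Proof.
elim/word_class_ind=> u; elim/word_class_ind=> v; elim/word_class_ind=> w.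
by rewrite !presented_mulE catA.
Qed.

Lemma presented_1mul : left_id presented_one presented_mul.
Proof. by elim/word_class_ind=> u; rewrite presented_mulE. Qed.

Lemma presented_mul1 : right_id presented_one presented_mul.
Proof. by elim/word_class_ind=> u; rewrite presented_mulE cats0. Qed.

HB.instance Definition _ :=
  isMonoid.Build presented_monoid presented_mulA presented_1mul presented_mul1.

End Presentation.

(* The letters a and b are [true] and [false]. *)
Definition BS_rel (c d : nat) (l m : seq bool) : Prop :=
  l = true :: nseq c false /\ m = rcons (nseq d false) true.

Definition BS (c d : nat) : monoidType := presented_monoid (BS_rel c d).
Definition BS_a (c d : nat) : BS c d := word_class (BS_rel c d) [:: true].
Definition BS_b (c d : nat) : BS c d := word_class (BS_rel c d) [:: false].

Section RightLCM.
Variable S : monoidType.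
Implicit Types (s t r x y f : S) (A F T : set S) (Z : set S).

Definition rideal s : set S := range (fun x => s * x).

Definition is_rlcm r s t : Prop := rideal s `&` rideal t = rideal r.

Definition right_LCM : Prop :=
  (forall s x y, s * x = s * y -> x = y) /\
  (forall s t, rideal s `&` rideal t = set0 \/ exists r, is_rlcm r s t).

Definition invertible : set S := [set x | exists y, x * y = 1 /\ y * x = 1].

Definition core : set S :=
  [set x | forall s, rideal x `&` rideal s !=set0].

Definition core_irr : set S :=
  [set s | ~ core s /\ forall t x, core x -> s = t * x -> invertible x].

Definition core_irr1 : set S := core_irr `|` [set 1].

Definition core_eq s t : Prop :=
  exists x y, [/\ core x, core y & s * x = t * y].

Definition core_class s : set S := [set t | core_eq s t].

Definition core_quot A : set (set S) := [set core_class s | s in A].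

Definition complete_reps A T : Prop :=
  T `<=` A /\ forall s, A s -> exists2 t, T t & core_eq s t.

Definition transversal A T : Prop :=
  complete_reps A T /\
  forall T', T' `<=` T -> complete_reps A T' -> T' = T.

Definition foundation_set F : Prop :=
  finite_set F /\
  forall s, exists2 f, F f & rideal s `&` rideal f !=set0.

Definition accurate F : Prop :=
  forall f f', F f -> F f' -> f <> f' -> rideal f `&` rideal f' = set0.

(* On a class [core_class s] this is [core_class (x * s)], see
   [core_actE] below. *)
Definition core_act x Z : set S :=
  [set t | exists2 s, Z s & core_eq (x * s) t].

Definition faithful_act : Prop :=
  forall x y, core x -> core y -> x <> y ->
    exists2 Z, core_quot setT Z & core_act x Z <> core_act y Z.

Definition almost_free_act : Prop :=
  forall x y, core x -> core y -> x <> y ->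
    finite_set [set Z | core_quot setT Z /\ core_act x Z = core_act y Z].

(* [is_core_part T s y]: y is the factor c(s) of s = i(s) c(s). *)
Definition is_core_part T s y : Prop :=
  core y /\ exists2 t, T t & s = t * y.

Definition core_parts T x : set S :=
  [set y | exists2 f, T f & is_core_part T (x * f) y].

Definition finite_propagation : Prop :=
  forall x y, core x -> core y ->
    exists T, [/\ transversal setT T, T `<=` core_irr1,
                  finite_set (core_parts T x) & finite_set (core_parts T y)].

Section CoreTheory.
Hypothesis lcmS : right_LCM.

Lemma core1 : core 1.
Proof.
move=> s; exists s; split; last by exists 1; rewrite ?mulg1.
by exists s; rewrite ?mul1g.
Qed.

Lemma coreM x y : core x -> core y -> core (x * y).
Proof.
move=> cx cy s; have [_ [[p _ <-] [q _ qE]]] := cx s.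
have [_ [[m _ <-] [n _ nE]]] := cy p.
exists (x * y * m); split; first by exists m.
by exists (q * n) => //; rewrite mulgA qE -!mulgA nE.
Qed.

Lemma core_reversible x y : core x -> core y ->
  exists p q, [/\ core p, core q & x * p = y * q].
Proof.
move=> cx cy; have [canS lcm] := lcmS.
have [xy0|[r rE]] := lcm x y.
  by have [z] := cx y; rewrite xy0.
have: rideal r r by exists 1; rewrite ?mulg1.
rewrite -rE => -[[p _ pE] [q _ qE]].
have cr s : rideal r `&` rideal s !=set0.
  have [_ [[u _ <-] [u' _ uE]]] := cy s.
  have [_ [[v _ <-] [w _ wE]]] := cx (y * u).
  exists (x * v); rewrite -rE; split; last first.
    by exists (u' * w) => //; rewrite mulgA uE.
  by split; [exists v|exists (u * w); rewrite ?mulgA].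
exists p, q; split; rewrite ?pE ?qE // => s.
- have [_ [[m _ <-] [n _ nE]]] := cr (x * s).
  exists (p * m); split; first by exists m.
  by exists n => //; apply: (canS x); rewrite !mulgA pE.
- have [_ [[m _ <-] [n _ nE]]] := cr (y * s).
  exists (q * m); split; first by exists m.
  by exists n => //; apply: (canS y); rewrite !mulgA qE.
Qed.

Lemma core_eq_refl s : core_eq s s.
Proof. by exists 1, 1; split=> //; exact: core1. Qed.

Lemma core_eq_sym s t : core_eq s t -> core_eq t s.
Proof. by move=> [x [y [cx cy xy]]]; exists y, x. Qed.

Lemma core_eq_trans t s r : core_eq s t -> core_eq t r -> core_eq s r.
Proof.
move=> [x [y [cx cy xy]]] [z [w [cz cw zw]]].
have [p [q [cp cq pq]]] := core_reversible cy cz.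
exists (x * p), (w * q); split; [exact: coreM|exact: coreM|].
by rewrite !mulgA xy -zw -!mulgA pq.
Qed.

Lemma core_actE x s : core_act x (core_class s) = core_class (x * s).
Proof.
apply/seteqP; split=> [t [s' ss' xst]|t xst]; last first.
  by exists s => //; exact: core_eq_refl.
apply: core_eq_trans xst; have [u [v [cu cv uv]]] := ss'.
by exists u, v; split=> //; rewrite -!mulgA uv.
Qed.

End CoreTheory.
End RightLCM.

Definition irreducibles (M : set nat) : set nat :=
  [set m | [/\ M m, m <> 1%N &
    forall k l, M k -> M l -> m = (k * l)%N -> k = 1%N \/ l = 1%N]].

(* Elements of the free abelian monoid on [irreducibles M] are lists up to
   permutation. *)
Definition free_on_irreducibles (M : set nat) : Prop :=
  (forall n, M n -> exists2 s : seq nat,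
     (forall m, m \in s -> irreducibles M m) & n = (\prod_(m <- s) m)%N) /\
  (forall s t : seq nat,
     (forall m, m \in s -> irreducibles M m) ->
     (forall m, m \in t -> irreducibles M m) ->
     (\prod_(m <- s) m = \prod_(m <- t) m)%N -> perm_eq s t).

Section Admissible.
Variables (S : monoidType) (N : S -> nat).

Definition scale_morphism : Prop :=
  [/\ forall s, (0 < N s)%N, N 1 = 1%N & forall s t, N (s * t) = (N s * N t)%N].

Definition generalised_scale : Prop :=
  [/\ scale_morphism,
      exists s, N s <> 1%N,
      forall n, range N n -> (core_quot (N @^-1` [set n]) #= `I_n)%card &
      forall n, range N n -> forall T, transversal (N @^-1` [set n]) T ->
        foundation_set T /\ accurate T].

(* Admissibility, with N as the generalised scale of (A3) and (A4). *)
Definition admissible_with : Prop :=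
  [/\ right_LCM S,
      forall s : S, exists t x, [/\ core_irr1 t, core x & s = t * x],
      forall s t r : S, core_irr s -> core_irr t -> is_rlcm r s t -> core_irr r,
      generalised_scale &
      free_on_irreducibles (range N)].

Variable R : realType.

Definition zeta (beta : R) : \bar R :=
  (\esum_(n in range N) (n%:R `^ (- (beta - 1)))%:E)%R.

Definition critical_candidates : set (\bar R) :=
  [set b | b != -oo%E /\ forall beta : R, (b < beta%:E)%E -> (zeta beta < +oo)%E].

Definition is_critical_inv_temp (b : \bar R) : Prop :=
  critical_candidates b /\ lbound critical_candidates b.

End Admissible.

(* Main.v *)
Require Import Defs.
From Stdlib Require Import Relation_Operators.
From mathcomp Require Import all_boot all_order all_algebra.
From mathcomp Require Import all_classical all_reals all_analysis.

(** Pushing powers of b to the right with b^d a = a b^c brings every element to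
    the form b^{j_1} a ... b^{j_k} a b^m with digits 0 <= j_i < d.  Moving b^n
    past the word w = j_1 ... j_k works like adding n to a number written in
    base d, least significant digit first, except that the quantity passed on
    to the next digit is c times the usual carry:
      b^n w = odometer_n(w) b^{carry_n(w)}.
    The form is unique because the letters act on pairs (w, m) by these very
    formulas and the action respects the defining relation.  Hence
      (u, m)(v, n) = (u ++ odometer_m(v), carry_m(v) + n)
    is a model of the monoid, and odometer_n permutes the words of each length.

    In the model everything becomes visible.  Write stem for w and bexp for m.
    Two right ideals meet exactly when one stem is a prefix of the other; after
    multiplying on the right to make the stems equal, the two elements differ
    by a power of b, so one ideal contains the other and the monoid is right
    LCM.  The core is the set of powers of b, core irreducibles are the
    elements with nonempty stem and bexp 0, and two elements are core
    equivalent iff their stems agree.  So N(s) = d^{size (stem s)} has d^k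
    classes at level d^k, namely the words of length k; its range is the
    monoid of powers of d, free on d, and the zeta function is the geometric
    series of ratio d^{-(beta-1)}, finite exactly for beta > 1.

    The core element b^n acts on the classes, that is on words, by odometer_n.
    If d divides c, then odometer_d is the identity: it fixes the first digit
    and passes on c, a multiple of d.  If d does not divide c, put
    g = gcd(c, d); a word of length k fixed by odometer_p with p > 0 forces
    p (c/d)^i to be divisible by d for all i < k, so (d/g)^k divides p and k is
    bounded: the action is almost free (odometer_fixed_dvd).  Almost freeness
    implies faithfulness because there are infinitely many classes.

    A transversal of core irreducibles must be the set of all words, so C_x for
    x = b^m is the set of the b^{carry_m(w)}, w ranging over all words.  One
    step turns m into at most c ceil(m/d) and reaches that value at the digit
    d-1.  If c <= d this keeps m below any multiple of d that bounds it; if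
    c > d the largest digit makes it grow strictly for ever. *)

Set Implicit Arguments.
Unset Strict Implicit.
Unset Printing Implicit Defensive.

Import Order.TTheory GRing.Theory Num.Theory.

Local Open Scope classical_set_scope.
Local Open Scope nat_scope.

(** * Words, finite sets and powers *)

Lemma prefix_comparable (T : eqType) (u v w : seq T) :
  prefix u w -> prefix v w -> prefix u v || prefix v u.
Proof.
rewrite !prefixE => /eqP uE /eqP vE.
have [uv|/ltnW vu] := leqP (size u) (size v); apply/orP; [left|right].
  by rewrite -{1}vE take_takel // uE.
by rewrite -{1}uE take_takel // vE.
Qed.

Lemma finite_words (T : finType) k :
  finite_set [set w : seq T | (size w <= k)%N].
Proof.
apply: (@sub_finite_set _ _ (\bigcup_(i in `I_k.+1) range (@tval i T))).
  by move=> w wk; exists (size w) => //; exists (in_tuple w).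
apply: bigcup_finite => // i _; exact/finite_image/finite_finset.
Qed.

Lemma card_eq_range_fin (T : finType) (U : Type) (f : T -> U) :
  injective f -> (range f #= `I_#|T|)%card.
Proof.
move=> f_inj; have fv_inj : injective (f \o @enum_val T T).
  exact: inj_comp f_inj (can_inj (@enum_valK T)).
have -> : range f = range (f \o @enum_val T T).
  apply/seteqP; split=> [_ [x _ <-]|_ [i _ <-]]; last by exists (enum_val i).
  by exists (enum_rank x) => //=; rewrite enum_rankK.
apply: card_eq_trans (inj_card_eq _) _; first by move=> i j _ _; exact: fv_inj.
by rewrite card_eq_sym; exact: card_II.
Qed.

Lemma irreducible_powers q m : (1 < q)%N ->
  irreducibles (range (expn q)) m <-> m = q.
Proof.
move=> q_gt1; split=> [[[[|k] _ <-] n1 irr]|->].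
- by case: n1; rewrite expn0.
- have Mq : range (expn q) q by exists 1%N; rewrite ?expn1.
  have Mqk : range (expn q) (q ^ k)%N by exists k.
  have [q1|qk] := irr _ _ Mq Mqk (expnS q k); first by move: q_gt1; rewrite q1.
  by rewrite expnS qk muln1.
- split; first by exists 1%N; rewrite ?expn1.
    by move=> q1; move: q_gt1; rewrite q1.
  move=> _ _ [i _ <-] [j _ <-] /eqP.
  rewrite -{1}(expn1 q) -expnD eqn_exp2l //.
  by case: i => [|i]; [left | case: j => [|j]; [right | rewrite addSn addnS]].
Qed.

Lemma free_on_irreducible_powers q : (1 < q)%N ->
  free_on_irreducibles (range (expn q)).
Proof.
move=> q_gt1.
have prodE (s : seq nat) :
    (forall m, m \in s -> irreducibles (range (expn q)) m) ->
    s = nseq (size s) q.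
  move=> sI; apply/all_pred1P/allP => m /sI.
  by move=> /(irreducible_powers m q_gt1) ->; exact: eqxx.
split=> [_ [k _ <-]|s t /prodE -> /prodE ->].
  exists (nseq k q); last by rewrite big_nseq iter_muln_1.
  by move=> m /nseqP[-> _]; apply/irreducible_powers.
rewrite !big_nseq !iter_muln_1 => /eqP; rewrite eqn_exp2l // => /eqP ->.
exact: perm_refl.
Qed.

(** * The odometer *)

Section Odometer.
Variables c d : nat.
Implicit Types (j : 'I_d) (u v w : seq 'I_d) (m n : nat).

Lemma digit_base_gt0 j : 0 < d.
Proof. exact: leq_ltn_trans (leq0n j) (ltn_ord j). Qed.

Definition digit_add n j : 'I_d :=
  Ordinal (ltn_pmod (n + j) (digit_base_gt0 j)).

Fixpoint odometer n w : seq 'I_d :=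
  if w is j :: w' then digit_add n j :: odometer (c * ((n + j) %/ d)) w'
  else [::].

Fixpoint carry n w : nat :=
  if w is j :: w' then carry (c * ((n + j) %/ d)) w' else n.

Lemma size_odometer n w : size (odometer n w) = size w.
Proof. by elim: w n => //= j w IHw n; rewrite IHw. Qed.

Lemma odometer_cat n u v :
  odometer n (u ++ v) = odometer n u ++ odometer (carry n u) v.
Proof. by elim: u n => [|j u IHu] n; rewrite /= ?IHu. Qed.

Lemma carry_cat n u v : carry n (u ++ v) = carry (carry n u) v.
Proof. by elim: u n => [|j u IHu] n; rewrite /= ?IHu. Qed.

Lemma odometer0_carry0 w : odometer 0 w = w /\ carry 0 w = 0.
Proof.
elim: w => //= j w [oE cE]; rewrite add0n divn_small // muln0 oE cE.
by split=> //; congr cons; apply: val_inj; rewrite /= add0n modn_small.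
Qed.

Lemma odometer0 w : odometer 0 w = w.
Proof. by case: (odometer0_carry0 w). Qed.

Lemma carry0 w : carry 0 w = 0.
Proof. by case: (odometer0_carry0 w). Qed.

(** The action and the cocycle are proved together, since the carry of the
    first digit is the number added to the remaining word. *)
Lemma odometer_carryD m n w :
  odometer (m + n) w = odometer m (odometer n w) /\
  carry (m + n) w = carry m (odometer n w) + carry n w.
Proof.
elim: w m n => //= j w IHw m n.
have dgt0 := digit_base_gt0 j.
(* Adding n and then m to a digit carries in total what adding m + n does. *)
have nE : m + n + j = (n + j) %/ d * d + (m + (n + j) %% d).
  by rewrite addnCA -divn_eq addnA.
have -> : c * ((m + n + j) %/ d) =
    c * ((m + (n + j) %% d) %/ d) + c * ((n + j) %/ d).
  by rewrite nE divnMDl // mulnDr addnC.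
have [-> ->] := IHw (c * ((m + (n + j) %% d) %/ d)) (c * ((n + j) %/ d)).
by split=> //; congr cons; apply: val_inj; rewrite /= nE modnMDl.
Qed.

Lemma odometerD m n w : odometer (m + n) w = odometer m (odometer n w).
Proof. by case: (odometer_carryD m n w). Qed.

Lemma carryD m n w : carry (m + n) w = carry m (odometer n w) + carry n w.
Proof. by case: (odometer_carryD m n w). Qed.

Lemma odometer_inj n : injective (odometer n).
Proof.
move=> u v; elim: u v n => [|i u IHu] [|j v] n //= [ij uv].
have {}ij : i = j.
  apply/val_inj/eqP; rewrite /= -(modn_small (ltn_ord i)).
  by rewrite -(modn_small (ltn_ord j)) -(eqn_modDl n) ij.
by rewrite -ij in uv *; rewrite (IHu v _ uv).
Qed.

(** The first digit of the preimage is u_1 - n modulo d; it determines the carry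
    that the recursive call has to undo. *)
Lemma odometer_surj n u : exists w, odometer n w = u.
Proof.
elim: u n => [|i u IHu] n; first by exists [::].
have dgt0 := digit_base_gt0 i.
pose j : 'I_d := Ordinal (ltn_pmod (i + (d - n %% d)) dgt0).
have [w wE] := IHu (c * ((n + j) %/ d)).
exists (j :: w); rewrite /= wE; congr cons; apply: val_inj => /=.
rewrite modnDmr addnCA -modnDmr -(modnDml n) subnKC ?modnn ?addn0 //.
  by rewrite modn_small.
by rewrite ltnW ?ltn_pmod.
Qed.

End Odometer.

(** * The normal form *)

Section NormalForm.
Variables c d : nat.
Hypothesis d_gt0 : 0 < d.
Local Notation S := (BS c d).
Local Notation cls := (word_class (BS_rel c d)).
Local Notation a := (BS_a c d).
Local Notation b := (BS_b c d).
Local Notation odometer := (odometer c).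
Local Notation carry := (carry c).
Implicit Types (s t x y : S) (u v w : seq 'I_d) (m n : nat).
Local Open Scope group_scope.

Fixpoint normal_form w m : S :=
  if w is j :: w' then b ^+ j * a * normal_form w' m else b ^+ m.

Lemma BS_mul_class (p q : seq bool) :
  (cls p : S) * (cls q : S) = cls (p ++ q).
Proof. exact: presented_mulE. Qed.

Lemma BS_b_exp n : b ^+ n = cls (nseq n false).
Proof.
elim: n => [|n IHn]; first by rewrite expg0.
by rewrite expgS IHn BS_mul_class.
Qed.

Lemma BS_relation : a * b ^+ c = b ^+ d * a.
Proof.
rewrite !BS_b_exp !BS_mul_class; apply/word_classP/rst_step.
have ab : BS_rel c d ([:: true] ++ nseq c false) (nseq d false ++ [:: true]).
  by split; rewrite ?cats1.
by have := RewriteStep [::] [::] ab; rewrite !cats0.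
Qed.

(** The source of the rule that a carry of q becomes c q. *)
Lemma BS_b_exp_a q : b ^+ (q * d) * a = a * b ^+ (c * q).
Proof.
elim: q => [|q IHq]; first by rewrite muln0 !expg0 mul1g mulg1.
by rewrite mulSn mulnS !expgnDr -mulgA IHq !mulgA -BS_relation.
Qed.

Lemma BS_b_exp_mul n w m :
  b ^+ n * normal_form w m = normal_form (odometer n w) (carry n w + m).
Proof.
elim: w n => [|j w IHw] n /=; first by rewrite expgnDr.
rewrite -IHw !mulgA -expgnDr {1}(divn_eq (n + j) d) addnC expgnDr.
by rewrite -(mulgA _ _ a) BS_b_exp_a !mulgA.
Qed.

Lemma normal_formM u m v n :
  normal_form u m * normal_form v n =
  normal_form (u ++ odometer m v) (carry m v + n).
Proof.
by elim: u => [|j u IHu] /=; [rewrite BS_b_exp_mul | rewrite -mulgA IHu].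
Qed.

Lemma normal_form_surj s : exists w m, s = normal_form w m.
Proof.
elim/word_class_ind: s => p; elim: p => [|x p [w [m wE]]].
  by exists [::], 0%N; rewrite /= expg0.
have -> : (cls (x :: p) : S) = cls [:: x] * cls p.
  by rewrite BS_mul_class.
rewrite wE; case: x; first by exists (Ordinal d_gt0 :: w), m; rewrite /= mul1g.
exists (odometer 1 w), (carry 1 w + m)%N.
by rewrite -BS_b_exp_mul expg1.
Qed.

(** Left multiplication by a letter, read on normal forms; its invariance under
    the relation separates distinct normal forms. *)
Definition letter_act (x : bool) (p : seq 'I_d * nat) : seq 'I_d * nat :=
  if x then (Ordinal d_gt0 :: p.1, p.2)
  else (odometer 1 p.1, (carry 1 p.1 + p.2)%N).

Definition word_act (p : seq bool) z := foldr letter_act z p.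

Lemma word_act_b n z :
  word_act (nseq n false) z = (odometer n z.1, (carry n z.1 + z.2)%N).
Proof.
elim: n => [|n IHn] /=; first by rewrite odometer0 carry0; case: z.
by rewrite IHn /= -odometerD addnA -carryD.
Qed.

Lemma word_act_rel (p q : seq bool) z :
  BS_rel c d p q -> word_act p z = word_act q z.
Proof.
move=> [-> ->]; rewrite -cats1 /word_act foldr_cat /= -/(word_act _ _).
rewrite -/(word_act _ (Ordinal d_gt0 :: _, _)) !word_act_b /= addn0.
rewrite divnn d_gt0 muln1; congr (_ :: _, _); apply: val_inj.
by rewrite /= addn0 modnn.
Qed.

Lemma word_act_cong (p q : seq bool) z :
  word_cong (BS_rel c d) p q -> word_act p z = word_act q z.
Proof.
move=> pq; elim: pq z => {p q}
  [_ _ [p q l m lm]|//|p q _ IH|p q r _ IHp _ IHq] z.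
- rewrite /word_act !foldr_cat; congr foldr.
  exact: word_act_rel lm.
- by rewrite IH.
- by rewrite IHp.
Qed.

Definition coords s : seq 'I_d * nat := word_act (repr s) ([::], 0%N).

Lemma coords_class (p : seq bool) :
  coords (cls p) = word_act p ([::], 0%N).
Proof. apply/word_act_cong/word_classP; exact: word_class_reprK. Qed.

Lemma coords_mul (p : seq bool) s :
  coords ((cls p : S) * s) = word_act p (coords s).
Proof.
elim/word_class_ind: s => q.
by rewrite BS_mul_class !coords_class /word_act foldr_cat.
Qed.

Lemma coords_normal_form w m : coords (normal_form w m) = (w, m).
Proof.
elim: w => [|j w IHw] /=.
  by rewrite BS_b_exp coords_class word_act_b /= addn0.
rewrite -mulgA BS_b_exp !coords_mul IHw word_act_b /= addn0.
rewrite divn_small // muln0 odometer0 carry0.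
by congr (_ :: _, _); apply: val_inj; rewrite /= addn0 modn_small.
Qed.

Definition stem s := (coords s).1.
Definition bexp s := (coords s).2.

Lemma stem_normal_form w m : stem (normal_form w m) = w.
Proof. by rewrite /stem coords_normal_form. Qed.

Lemma bexp_normal_form w m : bexp (normal_form w m) = m.
Proof. by rewrite /bexp coords_normal_form. Qed.

Lemma normal_formK s : normal_form (stem s) (bexp s) = s.
Proof.
have [w [m ->]] := normal_form_surj s.
by rewrite stem_normal_form bexp_normal_form.
Qed.

Lemma BS_ext s t : stem s = stem t -> bexp s = bexp t -> s = t.
Proof. by move=> st bst; rewrite -(normal_formK s) st bst normal_formK. Qed.

Lemma stemM s t : stem (s * t) = stem s ++ odometer (bexp s) (stem t).
Proof.
rewrite -{1}(normal_formK s) -{1}(normal_formK t) normal_formM.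
exact: stem_normal_form.
Qed.

Lemma bexpM s t : bexp (s * t) = (carry (bexp s) (stem t) + bexp t)%N.
Proof.
rewrite -{1}(normal_formK s) -{1}(normal_formK t) normal_formM.
exact: bexp_normal_form.
Qed.

Lemma stem1 : stem 1 = [::]. Proof. exact: (stem_normal_form [::] 0). Qed.
Lemma bexp1 : bexp 1 = 0%N. Proof. exact: (bexp_normal_form [::] 0). Qed.

Lemma stem_a : stem a = [:: Ordinal d_gt0].
Proof. by rewrite /stem coords_class. Qed.
Lemma stem_b : stem b = [::].
Proof. by rewrite /stem coords_class. Qed.


(** * Right ideals and right LCMs *)

Lemma rideal_refl s : rideal s s.
Proof. by exists 1; rewrite ?mulg1. Qed.

Lemma rideal_mul s x : rideal (s * x) `<=` rideal s.
Proof. by move=> _ [y _ <-]; exists (x * y); rewrite ?mulgA. Qed.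

Lemma rideal_sub s t : rideal s t -> rideal t `<=` rideal s.
Proof. by move=> [x _ <-]; exact: rideal_mul. Qed.

Lemma rideal_prefix s t : rideal s t -> prefix (stem s) (stem t).
Proof. by move=> [x _ <-]; rewrite stemM prefix_prefix. Qed.

Lemma rideal_stem s t : stem s = stem t -> (bexp s <= bexp t)%N -> rideal s t.
Proof.
move=> st bst; exists (normal_form [::] (bexp t - bexp s)) => //; apply: BS_ext.
  by rewrite stemM stem_normal_form cats0.
by rewrite bexpM stem_normal_form bexp_normal_form /= subnKC.
Qed.

Lemma rideal_bexp0 s t :
  bexp s = 0%N -> prefix (stem s) (stem t) -> rideal s t.
Proof.
move=> s0 /prefixP[v vE]; exists (normal_form v (bexp t)) => //; apply: BS_ext.
  by rewrite stemM stem_normal_form s0 odometer0.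
by rewrite bexpM stem_normal_form bexp_normal_form s0 carry0.
Qed.

Lemma BS_mulI s x y : s * x = s * y -> x = y.
Proof.
move=> sxy.
have xy : stem x = stem y.
  apply: (@odometer_inj c d (bexp s)); have := congr1 stem sxy.
  by rewrite !stemM => /eqP; rewrite eqseq_cat // => /andP[_ /eqP].
apply: BS_ext => //; have := congr1 bexp sxy.
by rewrite !bexpM xy => /addnI.
Qed.

(** An element s can be multiplied on the right to lengthen its stem by any
    prescribed word v, because the odometer is onto, and this can be done so
    that no element of sS above the longer stem is lost, because the odometer
    is injective. *)
Lemma rideal_refine s v : exists x, stem (s * x) = stem s ++ v /\
  forall t, rideal s t -> prefix (stem s ++ v) (stem t) -> rideal (s * x) t.
Proof.
have [w wE] := odometer_surj c (bexp s) v.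
exists (normal_form w 0); split; first by rewrite stemM stem_normal_form wE.
move=> _ [y _ <-] /prefixP[z]; rewrite stemM -catA => /eqP.
rewrite eqseq_cat // => /andP[_ /eqP yE].
have [z' z'E] := odometer_surj c (carry (bexp s) w) z.
have {}yE : stem y = w ++ z'.
  by apply: (@odometer_inj c d (bexp s)); rewrite yE odometer_cat wE z'E.
exists (normal_form z' (bexp y)) => //; rewrite -mulgA; congr (_ * _).
by rewrite -[RHS]normal_formK yE normal_formM odometer0 carry0.
Qed.

(** When one stem is a prefix of the other, refining makes the stems equal, and
    a large enough power of b on this common stem lies in both ideals. *)
Lemma meet_prefix s t :
  rideal s `&` rideal t !=set0 <->
  prefix (stem s) (stem t) || prefix (stem t) (stem s).
Proof.
split=> [[x [/rideal_prefix sx /rideal_prefix tx]]|].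
  exact: prefix_comparable sx tx.
wlog st : s t / prefix (stem s) (stem t) => [hw|_].
  case/orP=> [st|ts]; first by apply: hw => //; rewrite st.
  by rewrite setIC; apply: hw => //; rewrite ts.
case/prefixP: st => v vE; have [x [xE _]] := rideal_refine s v.
pose k := maxn (bexp (s * x)) (bexp t).
exists (normal_form (stem t) k); split.
  apply: (@rideal_mul s x); apply: rideal_stem.
    by rewrite stem_normal_form xE vE.
  by rewrite bexp_normal_form leq_maxl.
by apply: rideal_stem; rewrite ?stem_normal_form ?bexp_normal_form ?leq_maxr.
Qed.

(** Once the stems are equal the ideals are nested, so the LCM is either t or
    the refinement of s to the stem of t. *)
Lemma BS_right_LCM : right_LCM S.
Proof.
split; first exact: BS_mulI.
move=> s t.
have [/meet_prefix st|st0] := pselect (rideal s `&` rideal t !=set0).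
  2: by left; apply/eqP/negPn/negP => /set0P.
right; wlog {st} st : s t / prefix (stem s) (stem t) => [hw|].
  case/orP: st => [/hw//|/hw[r rE]]; exists r.
  by rewrite /is_rlcm setIC.
case/prefixP: (st) => v vE; have [x [xE sx]] := rideal_refine s v.
have [le|/ltnW le] := leqP (bexp (s * x)) (bexp t).
  exists t; apply/seteqP; split=> u; first by case.
  move=> tu; split=> //.
  apply: rideal_mul (rideal_sub _ tu); apply: rideal_stem le.
  by rewrite xE vE.
exists (s * x); apply/seteqP; split=> u.
  by move=> [su /rideal_prefix tu]; apply: sx => //; rewrite -vE.
move=> sxu; split; first exact: rideal_mul sxu.
by apply: rideal_sub sxu; apply: rideal_stem le; rewrite xE.
Qed.

(** * The core and core equivalence *)

Hypothesis d_gt1 : (1 < d)%N.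

(** A nonempty stem has a first digit, and an element whose stem starts with
    another digit has a disjoint ideal; since d > 1 there is such a digit. *)
Lemma coreP x : core x <-> stem x = [::].
Proof.
split=> [cx|x0 s]; last by apply/meet_prefix; rewrite x0 prefix0s.
case xE: (stem x) => [//|i v].
have iE (j : 'I_d) : i = j.
  have /meet_prefix := cx (normal_form [:: j] 0).
  by rewrite xE stem_normal_form => /orP[] /=; case: eqP.
by have := congr1 val (etrans (esym (iE (Ordinal d_gt0))) (iE (Ordinal d_gt1))).
Qed.

Lemma invertible_eq1 x : invertible x -> x = 1.
Proof.
move=> [y [xy1 _]].
have /eqP := congr1 stem xy1; rewrite stemM stem1 -size_eq0 size_cat addn_eq0.
rewrite size_odometer !size_eq0 => /andP[/eqP x0 /eqP y0].
apply: BS_ext; first by rewrite stem1.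
have /eqP := congr1 bexp xy1.
by rewrite bexpM y0 bexp1 addn_eq0 => /andP[/eqP].
Qed.

Lemma core_irrP s : core_irr s <-> stem s <> [::] /\ bexp s = 0%N.
Proof.
split=> [[ncs irr]|[s0 bs0]].
  split; first by move/coreP.
  have sE : s = normal_form (stem s) 0 * normal_form [::] (bexp s).
    by rewrite normal_formM /= cats0 add0n normal_formK.
  have /irr : core (normal_form [::] (bexp s)) by apply/coreP/stem_normal_form.
  move=> /(_ _ sE)/invertible_eq1/(congr1 bexp).
  by rewrite bexp1 bexp_normal_form.
split; first by move/coreP.
move=> t x /coreP x0 sE; have /eqP := bs0.
rewrite sE bexpM x0 addn_eq0 => /andP[_ /eqP bx0].
have -> : x = 1 by apply: BS_ext; rewrite ?stem1 ?bexp1.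
by exists 1; rewrite mulg1.
Qed.

Lemma core_irr1P s : core_irr1 s <-> bexp s = 0%N.
Proof.
split=> [[/core_irrP[]//|->]|bs0]; first exact: bexp1.
have [s0|/eqP s0] := eqVneq (stem s) [::]; last by left; apply/core_irrP.
by right; apply: BS_ext; rewrite ?stem1 ?bexp1.
Qed.

Lemma core_eqP s t : core_eq s t <-> stem s = stem t.
Proof.
split=> [[x [y [/coreP x0 /coreP y0 /(congr1 stem)]]]|st].
  by rewrite !stemM x0 y0 !cats0.
exists (normal_form [::] (bexp t)), (normal_form [::] (bexp s)).
split; try exact/coreP/stem_normal_form.
apply: BS_ext; rewrite ?stemM ?bexpM !stem_normal_form ?cats0 //.
by rewrite !bexp_normal_form addnC.
Qed.

Lemma core_classP s t : core_class s = core_class t <-> stem s = stem t.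
Proof.
split=> [st|st].
  apply/core_eqP; have : core_class t t by apply/core_eqP.
  by rewrite -st.
by apply/seteqP; split=> u /core_eqP su; apply/core_eqP; rewrite -su.
Qed.

Lemma core_class_stem s : core_class s = core_class (normal_form (stem s) 0).
Proof. by apply/core_classP; rewrite stem_normal_form. Qed.

Lemma BS_core_factorization s :
  exists t x : S, [/\ core_irr1 t, core x & s = t * x].
Proof.
exists (normal_form (stem s) 0), (normal_form [::] (bexp s)); split.
- exact/core_irr1P/bexp_normal_form.
- exact/coreP/stem_normal_form.
- by rewrite normal_formM /= cats0 add0n normal_formK.
Qed.

(** For core irreducibles ideals are determined by stems, so the LCM generates
    the same ideal as the one with the longer stem, hence equals it: the only
    invertible element is 1. *)
Lemma BS_core_irr_rlcm s t r :
  core_irr s -> core_irr t -> is_rlcm r s t -> core_irr r.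
Proof.
move=> irs irt rE.
have [sr tr] : rideal s r /\ rideal t r by have := rideal_refl r; rewrite -rE.
wlog st : s t irs irt rE sr tr / prefix (stem s) (stem t) => [hw|].
  have /orP[st|ts] := prefix_comparable (rideal_prefix sr) (rideal_prefix tr).
    exact: (hw s t).
  by apply: (hw t s) => //; rewrite /is_rlcm setIC.
have [[_ s0] [tn t0]] := ((core_irrP s).1 irs, (core_irrP t).1 irt).
have [y _ yE] : rideal r t.
  by rewrite -rE; split; [exact: rideal_bexp0 | exact: rideal_refl].
have [x _ xE] := tr.
suff : y = 1 by move=> y1; rewrite -yE y1 mulg1 in irt.
apply: invertible_eq1; exists x.
have yx : r * (y * x) = r * 1 by rewrite mulgA yE xE mulg1.
have xy : t * (x * y) = t * 1 by rewrite mulgA xE yE mulg1.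
by split; [exact: BS_mulI yx | exact: BS_mulI xy].
Qed.

(** * The generalised scale *)

Definition BS_scale s : nat := (d ^ size (stem s))%N.

Lemma BS_scale_range : range BS_scale = range (expn d).
Proof.
apply/seteqP; split=> [_ [s _ <-]|_ [k _ <-]]; first by exists (size (stem s)).
exists (normal_form (nseq k (Ordinal d_gt0)) 0) => //.
by rewrite /BS_scale stem_normal_form size_nseq.
Qed.

Lemma BS_scale_fiber k :
  BS_scale @^-1` [set (d ^ k)%N] = [set s | size (stem s) = k].
Proof.
apply/seteqP; split=> s /=; last by move=> <-.
by rewrite /BS_scale => /eqP; rewrite eqn_exp2l // => /eqP.
Qed.

(** Of two equivalent representatives one could be dropped, against
    minimality. *)
Lemma transversal_inj (A T : set S) s t :
  Defs.transversal A T -> T s -> T t -> stem s = stem t -> s = t.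
Proof.
move=> [[TA Tc] Tmin] Ts Tt st; apply: contrapT => nst.
suff TE : T `\ s = T by have : T s := Ts; rewrite -{1}TE => -[_]; apply.
apply: Tmin; first by move=> x [].
split=> [x [Tx _]|x Ax]; first exact: TA.
have [y Ty xy] := Tc x Ax.
have [ys|/eqP ys] := eqVneq y s; last by exists y.
exists t; first by split=> // /esym.
by apply/core_eqP; rewrite -st -ys; apply/core_eqP.
Qed.

Lemma BS_scale_classes k :
  (core_quot (BS_scale @^-1` [set (d ^ k)%N]) #= `I_(d ^ k))%card.
Proof.
rewrite BS_scale_fiber -[in `I_ _](card_ord d) -card_tuple.
have -> : core_quot [set s | size (stem s) = k] =
    range (fun t : k.-tuple 'I_d => core_class (normal_form t 0)).
  apply/seteqP; split=> [_ [s sk <-]|_ [t _ <-]].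
    rewrite core_class_stem; exists (tcast sk (in_tuple (stem s))) => //.
    by rewrite val_tcast.
  by exists (normal_form t 0) => //=; rewrite stem_normal_form size_tuple.
apply: card_eq_range_fin => u v /core_classP.
by rewrite !stem_normal_form; exact: val_inj.
Qed.

(** A transversal has exactly one element above each word of length k.  Distinct
    words of equal length are not prefixes of each other, which gives accuracy;
    every word is comparable with one of length k, which gives the foundation
    property. *)
Lemma BS_transversal_foundation k (T : set S) :
  Defs.transversal (BS_scale @^-1` [set (d ^ k)%N]) T ->
  foundation_set T /\ accurate T.
Proof.
rewrite BS_scale_fiber => TT; have [[Tk Tc] _] := TT.
have stem_inj : {in T &, injective stem}.
  by move=> s t; rewrite !inE => Ts Tt; exact: (transversal_inj TT).
split; last first.
  move=> s t Ts Tt nst; apply/eqP/negPn/negP => /set0P /meet_prefix pst.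
  apply: nst; apply: (transversal_inj TT) => //.
  move: pst; rewrite !prefixE (Tk _ Ts) (Tk _ Tt) -{1}(Tk _ Tt) -(Tk _ Ts).
  by rewrite !take_size => /orP[] /eqP.
split.
  rewrite -(eq_finite_set (inj_card_eq stem_inj)).
  have finW := @finite_words 'I_d k.
  apply: sub_finite_set finW => _ [s Ts <-] /=.
  by rewrite (Tk _ Ts).
(* Padding with zeros gives a word of length k also for shorter stems. *)
move=> s; pose w := take k (stem s ++ nseq k (Ordinal d_gt0)).
have wk : size w = k.
  by rewrite size_takel // size_cat size_nseq leq_addl.
have [|t Tt /core_eqP] := Tc (normal_form w 0); rewrite /= stem_normal_form //.
move=> wt; exists t => //; apply/meet_prefix; rewrite -wt.
apply: (@prefix_comparable _ _ _ (stem s ++ nseq k (Ordinal d_gt0))).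
  exact: prefix_prefix.
exact: prefix_take.
Qed.

Lemma BS_generalised_scale : generalised_scale BS_scale.
Proof.
split.
- split=> [s||s t]; first by rewrite expn_gt0 d_gt0.
    by rewrite /BS_scale stem1.
  by rewrite /BS_scale stemM size_cat size_odometer expnD.
- exists (normal_form [:: Ordinal d_gt0] 0).
  rewrite /BS_scale stem_normal_form expn1; apply/eqP.
  by rewrite neq_ltn d_gt1 orbT.
- move=> n; rewrite BS_scale_range => -[k _ <-]; exact: BS_scale_classes.
- move=> n; rewrite BS_scale_range => -[k _ <-] T.
  exact: BS_transversal_foundation.
Qed.

Lemma BS_admissible : admissible_with BS_scale.
Proof.
split.
- exact: BS_right_LCM.
- exact: BS_core_factorization.
- exact: BS_core_irr_rlcm.
- exact: BS_generalised_scale.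
- by rewrite BS_scale_range; exact: free_on_irreducible_powers.
Qed.

(** * The critical inverse temperature *)

Section CriticalTemperature.
Variable R : realType.
Local Open Scope ring_scope.

Lemma BS_zetaE (beta : R) : zeta BS_scale beta =
  (\sum_(0 <= k <oo) ((d%:R `^ (- (beta - 1))) ^+ k)%:E)%E.
Proof.
rewrite /zeta BS_scale_range.
rewrite (@reindex_esum _ _ _ setT _ (expn d)); last first.
  by split=> // i j _ _ /eqP; rewrite eqn_exp2l // => /eqP.
rewrite nneseries_esumT; last by move=> k; rewrite lee_fin exprn_ge0 ?powR_ge0.
apply: eq_esum => k _; congr (_%:E).
by rewrite -powR_mulrn ?powR_ge0 // -powRrM mulrC powRrM powR_mulrn // natrX.
Qed.

Lemma BS_zeta1 : zeta BS_scale (1 : R) = +oo%E.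
Proof.
rewrite BS_zetaE subrr oppr0 powRr0; apply/eqyP => A _.
under eq_eseriesr do rewrite expr1n.
apply: le_trans _ (nneseries_lim_ge (Num.bound `|A|) _); last first.
  by move=> k _ _; rewrite lee_fin.
rewrite sumEFin sumr_const_nat subn0 lee_fin.
exact: le_trans (ler_norm A) (ltW (Num.Theory.archi_boundP (normr_ge0 A))).
Qed.

Lemma BS_zeta_lty (beta : R) : 1 < beta -> (zeta BS_scale beta < +oo)%E.
Proof.
move=> beta1; rewrite BS_zetaE.
set q := _ `^ _.
have q0 : 0 < q by rewrite powR_gt0 // ltr0n.
have q1 : `|q| < 1.
  rewrite gtr0_norm // /q powRN invf_lt1 ?powR_gt0 ?ltr0n //.
  have : (1 : R) `^ (beta - 1) < d%:R `^ (beta - 1).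
    by apply: gt0_ltr_powR; rewrite ?nnegrE ?subr_gt0 ?ltr1n.
  by rewrite powR1.
apply: (@le_lt_trans _ _ (1 * (1 - q)^-1)%:E); last exact: ltry.
apply: lime_le.
  by apply: is_cvg_nneseries => k _ _; rewrite lee_fin exprn_ge0 // ltW.
apply: nearW => n; rewrite sumEFin lee_fin.
have := geometric_le_lim n ler01 q0 q1; congr (_ <= _).
by rewrite /series /=; apply: eq_bigr => k _; rewrite mul1r.
Qed.


(** No bound below 1 qualifies, as at beta = 1 all terms of the series are 1. *)
Lemma BS_critical_temperature :
  is_critical_inv_temp BS_scale (1%:E : \bar R).
Proof.
split; first by split=> // beta; rewrite lte_fin; exact: BS_zeta_lty.
move=> e [_ he]; rewrite leNgt; apply/negP => /he.
by rewrite BS_zeta1 ltxx.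
Qed.

End CriticalTemperature.

(** * The action on the classes *)

Lemma core_act_eq x y s : core x -> core y ->
  core_act x (core_class s) = core_act y (core_class s) <->
  odometer (bexp x) (stem s) = odometer (bexp y) (stem s).
Proof.
move=> /coreP x0 /coreP y0; rewrite !(core_actE BS_right_LCM).
by split=> [/core_classP|xy]; [|apply/core_classP]; rewrite !stemM x0 y0.
Qed.

(** If the first digit is fixed, then p = d q and the rest of the word is fixed
    by odometer_{c q}.  By induction (d/g)^k divides c q with g = gcd(c, d),
    hence g q as d/g is coprime to c/g, and multiplying by d/g gives p = (d/g) g q. *)
Lemma odometer_fixed_dvd p w :
  odometer p w = w -> ((d %/ gcdn c d) ^ size w %| p)%N.
Proof.
elim: w p => [|j w IHw] p /=; first by rewrite expn0 dvd1n.
move=> [jE wE].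
have /dvdnP[q pE] : (d %| p)%N.
  have /eqP := congr1 val jE; rewrite /= -{2}(modn_small (ltn_ord j)).
  by rewrite -{2}(add0n (j : nat)) eqn_modDr mod0n.
have qE : ((p + j) %/ d = q)%N.
  by rewrite pE divnMDl // divn_small // addn0.
rewrite qE in wE; move: (IHw _ wE).
have g_gt0 : (0 < gcdn c d)%N by rewrite gcdn_gt0 d_gt0 orbT.
have cop : coprime ((d %/ gcdn c d) ^ size w) (c %/ gcdn c d).
  apply: coprimeXl; rewrite /coprime -(eqn_pmul2r g_gt0) muln_gcdl mul1n.
  by rewrite !divnK ?dvdn_gcdl ?dvdn_gcdr // gcdnC.
have <- : (d %/ gcdn c d * (gcdn c d * q) = p)%N.
  by rewrite mulnA divnK ?dvdn_gcdr // mulnC pE.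
have <- : (c %/ gcdn c d * (gcdn c d * q) = c * q)%N.
  by rewrite mulnA divnK ?dvdn_gcdl.
rewrite (Gauss_dvdr _ cop) expnS dvdn_pmul2l //.
by rewrite divn_gt0 // dvdn_leq // dvdn_gcdr.
Qed.

(** Cancelling the smaller of m and n turns agreement into a fixed point of
    odometer_{n-m}, and (d/g)^k divides n-m with d/g at least 2. *)
Lemma odometer_agree_size m n w : ~ (d %| c)%N -> m <> n ->
  odometer m w = odometer n w -> (size w <= maxn m n)%N.
Proof.
move=> ndc; wlog mn : m n / (m < n)%N => [hw mn e|_].
  have /orP[lt|lt] : (m < n)%N || (n < m)%N by rewrite -neq_ltn; apply/eqP.
    exact: hw.
  by rewrite maxnC; apply: hw => //; exact/nesym.
rewrite -{1}(subnKC (ltnW mn)) odometerD.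
move=> /odometer_inj/esym/odometer_fixed_dvd dvd.
have base_gt1 : (1 < d %/ gcdn c d)%N.
  have := dvdn_gcdr c d; rewrite ltn_neqAle divn_gt0 ?gcdn_gt0 ?d_gt0 ?orbT //.
  move=> gd; rewrite dvdn_leq // andbT; apply/eqP => e.
  by apply: ndc; rewrite -(divnK gd) -e mul1n dvdn_gcdl.
have {}dvd := dvdn_leq (eq_ind_r _ mn (subn_gt0 m n)) dvd.
apply: leq_trans (leq_maxr m n); apply: leq_trans (leq_subr m n).
exact: leq_trans (ltnW (ltn_expl _ base_gt1)) dvd.
Qed.

(** Stated for all multiples d k so that the induction sees the carry c k, again
    a multiple of d. *)
Lemma odometer_dvd_id k w : (d %| c)%N -> odometer (d * k) w = w.
Proof.
move=> /dvdnP[e ->]; elim: w k => //= j w IHw k.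
congr cons; first by apply: val_inj; rewrite /= mulnC modnMDl modn_small.
by rewrite (mulnC d k) divnMDl // divn_small // addn0 -(mulnA e d k) mulnCA IHw.
Qed.

Lemma almost_free_ndvd : ~ (d %| c)%N -> almost_free_act S.
Proof.
move=> ndc x y cx cy xy.
have bxy : bexp x <> bexp y.
  move=> b_eq; apply: xy; apply: BS_ext => //.
  by move: cx cy => /coreP -> /coreP ->.
pose W := [set w : seq 'I_d | (size w <= maxn (bexp x) (bexp y))%N].
apply: (@sub_finite_set _ _ ((fun w => core_class (normal_form w 0)) @` W)).
  move=> _ [[s _ <-] /(core_act_eq _ cx cy) sxy].
  exists (stem s); rewrite -?core_class_stem //.
  exact: odometer_agree_size sxy.
exact/finite_image/finite_words.
Qed.

Lemma infinite_core_quot : infinite_set (@core_quot S setT).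
Proof.
pose f k := core_class (normal_form (nseq k (Ordinal d_gt0)) 0).
have f_inj : injective f.
  move=> k l /core_classP; rewrite !stem_normal_form => /(congr1 size).
  by rewrite !size_nseq.
apply: (@sub_infinite_set _ (range f)).
  by move=> _ [k _ <-]; exists (normal_form (nseq k (Ordinal d_gt0)) 0).
rewrite (eq_finite_set (inj_card_eq _)); first exact: infinite_nat.
by move=> k l _ _; exact: f_inj.
Qed.

Lemma almost_free_faithful : almost_free_act S -> faithful_act S.
Proof.
move=> af x y cx cy xy.
have [Z [ZS nZ]] :=
  infinite_setN0 (infinite_setD infinite_core_quot (af x y cx cy xy)).
by exists Z => // e; apply: nZ.
Qed.

Lemma faithful_ndvd : faithful_act S -> ~ (d %| c)%N.
Proof.
move=> fa dc.
have cb : core (normal_form [::] d) by apply/coreP/stem_normal_form.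
have c1 : core (1 : S) by exact/coreP/stem1.
have [|_ [s _ <-]] := fa _ _ cb c1.
  move/(congr1 bexp); rewrite bexp_normal_form bexp1 => d0.
  by move: d_gt0; rewrite d0.
apply; apply/(core_act_eq _ cb c1).
rewrite bexp_normal_form bexp1 odometer0.
by have := odometer_dvd_id 1 (stem s) dc; rewrite muln1.
Qed.

(** * Finite propagation *)

(** Bounds that are multiples of d are stable: m <= d M gives
    c ceil(m/d) <= c M <= d M. *)
Lemma carry_le M m w : (c <= d)%N -> (m <= d * M)%N -> (carry m w <= d * M)%N.
Proof.
move=> cd; elim: w m => //= j w IHw m mM; apply: IHw.
apply: leq_mul cd _; rewrite -ltnS ltn_divLR // mulSn.
by rewrite (addnC m) -addSn leq_add // mulnC.
Qed.

(** For the largest digit the carry is c ceil(m/d), which is at least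
    (d+1) ceil(m/d) and so exceeds m. *)
Lemma carry_gt m (j : 'I_d) : (d < c)%N -> (0 < m)%N -> j.+1 = d :> nat ->
  (m < carry m [:: j])%N.
Proof.
move=> dc m0 jd /=.
have q_gt0 : (0 < (m + j) %/ d)%N.
  by rewrite divn_gt0 // -{1}jd -add1n leq_add2r.
have mq : (m <= d * ((m + j) %/ d))%N.
  have := ltn_ceil (m + j) d_gt0.
  by rewrite mulSn -{2}jd addSn ltnS addnC leq_add2l mulnC.
by apply: leq_ltn_trans mq _; rewrite ltn_pmul2r.
Qed.

(** Used as the witness when c <= d; core_partsE shows that the sets C_x do not
    depend on the choice of a transversal of core irreducibles. *)
Lemma transversal_bexp0 : Defs.transversal setT [set s : S | bexp s = 0%N].
Proof.
split.
  split=> // s _; exists (normal_form (stem s) 0).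
    exact: bexp_normal_form.
  by apply/core_eqP; rewrite stem_normal_form.
move=> T T0 [_ Tc]; apply/seteqP; split=> // s s0.
have [t Tt /core_eqP st] := Tc s I.
by have -> : s = t by apply: BS_ext => //; rewrite s0 (T0 _ Tt).
Qed.

Lemma core_partsE (T : set S) x :
  Defs.transversal setT T -> T `<=` @core_irr1 S -> core x ->
  core_parts T x =
    [set normal_form [::] (carry (bexp x) w) | w in [set: seq 'I_d]].
Proof.
move=> [[_ Tc] _] Tirr /coreP x0.
have T0 s : T s -> bexp s = 0%N by move=> /Tirr/core_irr1P.
have Tw w : T (normal_form w 0).
  have [t Tt /core_eqP] := Tc (normal_form w 0) I.
  rewrite stem_normal_form => wE.
  by have -> : normal_form w 0 = t by rewrite wE -(T0 _ Tt) normal_formK.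
apply/seteqP; split=> [y [f Tf [/coreP y0 [t Tt /(congr1 bexp)]]]|_ [w _ <-]].
  rewrite !bexpM (T0 _ Tf) (T0 _ Tt) carry0 addn0 add0n => yE.
  by exists (stem f) => //; rewrite yE -y0 normal_formK.
exists (normal_form w 0) => //; split; first exact/coreP/stem_normal_form.
exists (normal_form (odometer (bexp x) w) 0) => //.
by rewrite -{1}(normal_formK x) x0 !normal_formM /= cats0 addn0.
Qed.

(** When c > d the failure already occurs for x = b, along the words made of the
    digit d-1. *)
Lemma BS_finite_propagation : finite_propagation S <-> (c <= d)%N.
Proof.
split=> [fp|cd x y cx cy].
  rewrite leqNgt; apply/negP => dc.
  have cb : core (normal_form [::] 1) by apply/coreP/stem_normal_form.
  have [T [TT Tirr]] := fp _ _ cb cb; rewrite (core_partsE TT Tirr cb) => fin _.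
  have last_lt : (d.-1 < d)%N by rewrite prednK.
  pose f k := carry 1 (nseq k (Ordinal last_lt)).
  have f_gt0 k : (0 < f k)%N /\ (f k < f k.+1)%N.
    have step l : (0 < f l)%N -> (f l < f l.+1)%N.
      move=> fl; rewrite {2}/f -[l.+1]addn1 nseqD carry_cat.
      apply: carry_gt => //=.
      by rewrite prednK.
    suff fk : (0 < f k)%N by split=> //; exact: step.
    by elim: k => // k IHk; apply: ltn_trans IHk (step _ IHk).
  have f_mono : {homo f : k l / (k < l)%N}.
    by apply: homo_ltn => [l k m|k]; [exact: ltn_trans | case: (f_gt0 k)].
  have f_inj : injective f by exact: incn_inj (leq_mono f_mono).
  apply: infinite_nat.
  rewrite -(eq_finite_set (inj_card_eq (f := f) _)); last first.
    by move=> k l _ _; exact: f_inj.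
  apply: sub_finite_set (finite_image bexp fin) => _ [k _ <-].
  exists (normal_form [::] (f k)); last exact: bexp_normal_form.
  by exists (nseq k (Ordinal last_lt)) => //; rewrite bexp_normal_form.
have Tirr : [set s : S | bexp s = 0%N] `<=` @core_irr1 S.
  by move=> s /core_irr1P.
have fin z : core z -> finite_set (core_parts [set s : S | bexp s = 0%N] z).
  move=> cz; rewrite (core_partsE transversal_bexp0 Tirr cz).
  have finI := finite_image (normal_form [::]) (finite_II (d * bexp z).+1).
  apply: sub_finite_set finI.
  move=> _ [w _ <-]; exists (carry (bexp z) w) => //=.
  by rewrite ltnS carry_le // leq_pmull.
exists [set s : S | bexp s = 0%N]; split=> //.
- exact: transversal_bexp0.
- exact: fin.
- exact: fin.
Qed.

End NormalForm.

Theorem proposition5p10 (R : realType) (c d : nat)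
    (hcd : (1 < c * d)%N) (hd : (1 < d)%N) :
  (exists N : BS c d -> nat,
     [/\ N (BS_a c d) = d, N (BS_b c d) = 1%N, admissible_with N &
         is_critical_inv_temp N (1%:E : \bar R)]) /\
  ((almost_free_act (BS c d) <-> faithful_act (BS c d)) /\
   (faithful_act (BS c d) <-> ~ (d %| c)%N)) /\
  (finite_propagation (BS c d) <-> (c <= d)%N).
Proof.
have d_gt0 := ltnW hd.
split; last split.
- exists (BS_scale d_gt0); split.
  + by rewrite /BS_scale stem_a expn1.
  + by rewrite /BS_scale stem_b.
  + exact: BS_admissible.
  + exact: BS_critical_temperature.
- have nfa : ~ (d %| c)%N -> faithful_act (BS c d).
    by move=> /(almost_free_ndvd d_gt0 hd)/(almost_free_faithful d_gt0 hd).
  split; split=> //.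
  + exact: almost_free_faithful.
  + by move=> /(faithful_ndvd d_gt0 hd); exact: almost_free_ndvd.
  + exact: faithful_ndvd.
- exact: BS_finite_propagation.
Qed.
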